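(* Let $\phi\in\Gamma_0(\mathbb{R}^m)$ be Legendre and $\mathcal{C}^2$ on $\operatorname{int}(\operatorname{dom}\phi)$. Let $f:\mathbb{R}^m\to\overline{\mathbb{R}}$ be extended real-valued, $\bar x\in\operatorname{int}(\operatorname{dom}\phi)$ and $\bar v\in\mathbb{R}^m$. If $f$ is relatively prox-regular (relative to $\phi$) at $\bar x$ for $\bar v$, then $f$ is also prox-regular (in the classical sense) at $\bar x$ for $\bar v$. The converse is true if, furthermore, $\nabla^2\phi(x)$ is positive definite for any $x\in\operatorname{int}(\operatorname{dom}\phi)$, i.e. $\phi$ is very strictly convex.
   Context: $\overline{\mathbb{R}}=\mathbb{R}\cup\{-\infty,\infty\}$; $\Gamma_0(\mathbb{R}^m)$ is the set of proper lsc convex functions $\mathbb{R}^m\to\overline{\mathbb{R}}$. $\phi\in\Gamma_0(\mathbb{R}^m)$ is Legendre if it is essentially smooth ($\operatorname{int}(\operatorname{dom}\phi)\neq\emptyset$, $\phi$ is differentiable on $\operatorname{int}(\operatorname{dom}\phi)$, and $\|\nabla\phi(x^\nu)\|\to\infty$ whenever $x^\nu\to x\in\operatorname{bdry}\operatorname{dom}\phi$) and essentially strictly convex (strictly convex on every convex subset of $\operatorname{dom}\partial\phi$). $D_\phi(x,y)=\phi(x)-\phi(y)-\langle\nabla\phi(y),x-y\rangle$ if $y\in\operatorname{int}(\operatorname{dom}\phi)$, $+\infty$ otherwise. $\partial f$ is the limiting (Mordukhovich) subdifferential. $f$ is locally lsc at $\bar x$ (where $f$ is finite) if there is $\epsilon>0$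 such that all sets $\{x:\|x-\bar x\|\le\epsilon,\ f(x)\le\alpha\}$ with $\alpha\le f(\bar x)+\epsilon$ are closed. $f$ is relatively prox-regular at $\bar x\in\operatorname{int}(\operatorname{dom}\phi)$ for $\bar v$ if $f$ is finite and locally lsc at $\bar x$, $\bar v\in\partial f(\bar x)$, and there exist $\epsilon>0$, $r\ge0$ such that for all $\|x'-\bar x\|<\epsilon$, $\|x-\bar x\|<\epsilon$ (with $\epsilon$ sufficiently small that $x,x'\in\operatorname{int}(\operatorname{dom}\phi)$), $f(x')\ge f(x)+\langle v,x'-x\rangle-rD_\phi(x',x)$ whenever $f(x)-f(\bar x)<\epsilon$, $v\in\partial f(x)$, $\|v-\bar v\|<\epsilon$. Classical prox-regularity is the case $\phi=\frac12\|\cdot\|^2$, i.e. with $rD_\phi(x',x)$ replaced by $\frac r2\|x'-x\|^2$. *)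

(* Defs.v *)
From HB Require Import structures.
From mathcomp Require Import all_boot all_order all_algebra.
From mathcomp Require Import all_classical all_reals all_analysis.

Set Implicit Arguments.
Unset Strict Implicit.
Unset Printing Implicit Defensive.

Import Order.TTheory GRing.Theory Num.Theory.
Import numFieldNormedType.Exports.

Local Open Scope classical_set_scope.
Local Open Scope ring_scope.

(* Vectors of R^m are row vectors. The library norm on 'rV[R]_m is the sup
   norm; it is used only for the topology and for differentiability, which do
   not depend on the choice of the norm. *)

Definition dotp (R : realType) (m : nat) (u v : 'rV[R]_m) : R :=
  (u *m v^T) 0 0.

Definition enorm (R : realType) (m : nat) (u : 'rV[R]_m) : R :=
  Num.sqrt (dotp u u).

(* On the interior of its domain, a proper phi : 'rV[R]_m -> \bar R is the real
   function [fine \o phi]: the functions g below are of this form and matter on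
   an open set only. *)

Definition gradient (R : realType) (m : nat) (g : 'rV[R]_m -> R)
    (x : 'rV[R]_m) : 'rV[R]_m :=
  \row_i 'D_(delta_mx 0 i) g x.

Definition hessian (R : realType) (m : nat) (g : 'rV[R]_m -> R)
    (x : 'rV[R]_m) : 'M[R]_m :=
  'J (gradient g) x.

Definition C2_on (R : realType) (m : nat) (U : set 'rV[R]_m)
    (g : 'rV[R]_m -> R) : Prop :=
  forall x, U x ->
    [/\ differentiable g x, differentiable (gradient g) x
      & {for x, continuous (hessian g)}].

Definition posdef (R : realType) (m : nat) (A : 'M[R]_m) : Prop :=
  forall u : 'rV[R]_m, u != 0 -> 0 < dotp (u *m A) u.

Definition edom (R : realType) (m : nat) (phi : 'rV[R]_m -> \bar R) :
    set 'rV[R]_m :=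
  [set x | (phi x < +oo)%E].

Definition bdry (R : realType) (m : nat) (A : set 'rV[R]_m) : set 'rV[R]_m :=
  closure A `\` interior A.

Definition proper (R : realType) (m : nat) (phi : 'rV[R]_m -> \bar R) : Prop :=
  edom phi !=set0 /\ forall x, (-oo < phi x)%E.

Definition econvex (R : realType) (m : nat) (phi : 'rV[R]_m -> \bar R) :
    Prop :=
  forall (x y : 'rV[R]_m) (t : R), 0 < t < 1 ->
    (phi (t *: x + (1 - t) *: y)%R
       <= t%:E * phi x + (1 - t)%:E * phi y)%E.

Definition estrictly_convex_on (R : realType) (m : nat) (C : set 'rV[R]_m)
    (phi : 'rV[R]_m -> \bar R) : Prop :=
  forall (x y : 'rV[R]_m) (t : R), C x -> C y -> x != y -> 0 < t < 1 ->
    (phi (t *: x + (1 - t) *: y)%R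
       < t%:E * phi x + (1 - t)%:E * phi y)%E.

Definition Gamma0 (R : realType) (m : nat) (phi : 'rV[R]_m -> \bar R) : Prop :=
  [/\ proper phi, lower_semicontinuous phi & econvex phi].

(* Regular (Frechet) subgradients:
   f x' >= f x + <v, x' - x> + o(|x' - x|) as x' tends to x. *)
Definition regular_subdiff (R : realType) (m : nat) (f : 'rV[R]_m -> \bar R)
    (x : 'rV[R]_m) : set 'rV[R]_m :=
  [set v | f x \is a fin_num /\
     forall e : R, 0 < e -> \forall x' \near x,
       (f x + (dotp v (x' - x) - e * enorm (x' - x))%:E <= f x')%E].

(* Limiting (Mordukhovich) subgradients; empty where f is not finite. *)
Definition limiting_subdiff (R : realType) (m : nat) (f : 'rV[R]_m -> \bar R)
    (x : 'rV[R]_m) : set 'rV[R]_m :=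
  [set v | f x \is a fin_num /\
     exists xs vs : nat -> 'rV[R]_m,
       [/\ xs n @[n --> \oo] --> x,
           f (xs n) @[n --> \oo] --> f x,
           forall n, regular_subdiff f (xs n) (vs n)
         & vs n @[n --> \oo] --> v]].

Definition essentially_smooth (R : realType) (m : nat)
    (phi : 'rV[R]_m -> \bar R) : Prop :=
  [/\ interior (edom phi) !=set0,
      forall x, interior (edom phi) x -> differentiable (fine \o phi) x
    & forall (xs : nat -> 'rV[R]_m) (x : 'rV[R]_m),
        (forall n, interior (edom phi) (xs n)) ->
        bdry (edom phi) x -> xs n @[n --> \oo] --> x ->
        enorm (gradient (fine \o phi) (xs n)) @[n --> \oo] --> +oo].

Definition essentially_strictly_convex (R : realType) (m : nat)
    (phi : 'rV[R]_m -> \bar R) : Prop :=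
  forall C : set 'rV[R]_m, convex_set C ->
    C `<=` [set x | limiting_subdiff phi x !=set0] ->
    estrictly_convex_on C phi.

Definition legendre (R : realType) (m : nat) (phi : 'rV[R]_m -> \bar R) :
    Prop :=
  essentially_smooth phi /\ essentially_strictly_convex phi.

Definition bregman (R : realType) (m : nat) (phi : 'rV[R]_m -> \bar R)
    (x y : 'rV[R]_m) : \bar R :=
  if y \in (interior (edom phi) : set 'rV[R]_m) then
    (phi x - phi y - (dotp (gradient (fine \o phi) y) (x - y))%:E)%E
  else +oo%E.

Definition locally_lsc (R : realType) (m : nat) (f : 'rV[R]_m -> \bar R)
    (xbar : 'rV[R]_m) : Prop :=
  exists2 e : R, 0 < e &
    forall a : R, (a%:E <= f xbar + e%:E)%E ->
      closed [set x | enorm (x - xbar) <= e /\ (f x <= a%:E)%E].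

(* Common part of the relative and of the classical notion: B x' x is the
   penalty, used at points x', x of U only. *)
Definition prox_regular_for (R : realType) (m : nat) (U : set 'rV[R]_m)
    (B : 'rV[R]_m -> 'rV[R]_m -> \bar R) (f : 'rV[R]_m -> \bar R)
    (xbar vbar : 'rV[R]_m) : Prop :=
  [/\ U xbar, f xbar \is a fin_num, locally_lsc f xbar,
      limiting_subdiff f xbar vbar
    & exists e r : R,
        [/\ 0 < e, 0 <= r,
            forall x, enorm (x - xbar) < e -> U x
          & forall x' x v : 'rV[R]_m,
              enorm (x' - xbar) < e -> enorm (x - xbar) < e ->
              (f x - f xbar < e%:E)%E ->
              limiting_subdiff f x v -> enorm (v - vbar) < e ->
              (f x + (dotp v (x' - x))%:E - r%:E * B x' x <= f x')%E]].

Definition relatively_prox_regular (R : realType) (m : nat)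
    (phi : 'rV[R]_m -> \bar R) : ('rV[R]_m -> \bar R) ->
    'rV[R]_m -> 'rV[R]_m -> Prop :=
  prox_regular_for (interior (edom phi)) (bregman phi).

(* The penalty is the Bregman distance of x |-> 1/2 |x|^2. *)
Definition prox_regular (R : realType) (m : nat) : ('rV[R]_m -> \bar R) ->
    'rV[R]_m -> 'rV[R]_m -> Prop :=
  prox_regular_for setT (fun x' x => (2^-1 * enorm (x' - x) ^+ 2)%:E).

(* Main.v *)
Require Import Defs.
From HB Require Import structures.
From mathcomp Require Import all_boot all_order all_algebra.
From mathcomp Require Import all_classical all_reals all_analysis.
From mathcomp Require Import ring lra.
Import Order.TTheory GRing.Theory Num.Theory.
Import numFieldNormedType.Exports.
Local Open Scope classical_set_scope.
Local Open Scope ring_scope.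

Set Implicit Arguments.
Unset Strict Implicit.
Unset Printing Implicit Defensive.

(** The two notions differ only in the penalty: the Bregman distance
    D(x', x) of phi on one side, 1/2 |x' - x|^2 on the other. It is therefore
    enough that, for x and x' in some ball around xbar, each penalty is at most
    a constant times the other; the constant is then absorbed in r
    ([prox_regular_for_le]).

    With d = x' - x, the second-order Taylor formula along the segment from x
    to x', with Lagrange remainder, gives
      D(x', x) = 1/2 <d H(z), d>
    for some z on that segment, where H is the Hessian of phi
    ([bregman_qform]). Balls are convex, so z stays near xbar and the question
    is about the quadratic forms of H(z) for z near xbar:
    - by continuity of H at xbar they are bounded above by C |d|^2
      ([qform_near_le]), hence the Bregman penalty is at most C times the
      Euclidean one, and relative prox-regularity implies the classical one;
    - if H(xbar) is positive definite, compactness of the unit sphere bounds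
      its form below by a positive multiple of |d|^2 ([posdef_coercive]); by
      continuity half of that bound survives for z near xbar
      ([qform_near_ge]), which gives the converse.

    The quadratic forms are estimated with the sup norm of matrices, for which
    continuity of H is formulated; |u|_sup^2 <= <u, u> <= m |u|_sup^2
    passes to the Euclidean norm. *)

(** * Inner product, Euclidean norm and sup norm *)

Lemma dotpE (R : realType) (m : nat) (u v : 'rV[R]_m) :
  dotp u v = \sum_i u 0 i * v 0 i.
Proof. by rewrite /dotp mxE; apply: eq_bigr => i _; rewrite mxE. Qed.

Lemma dotpBl (R : realType) (m : nat) (u v w : 'rV[R]_m) :
  dotp (u - v) w = dotp u w - dotp v w.
Proof. by rewrite /dotp mulmxBl !mxE. Qed.

Lemma dotpZl (R : realType) (m : nat) (a : R) (u v : 'rV[R]_m) :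
  dotp (a *: u) v = a * dotp u v.
Proof. by rewrite /dotp -scalemxAl mxE. Qed.

Lemma dotpZr (R : realType) (m : nat) (a : R) (u v : 'rV[R]_m) :
  dotp u (a *: v) = a * dotp u v.
Proof. by rewrite /dotp linearZ -scalemxAr mxE. Qed.

Lemma dotp_ge0 (R : realType) (m : nat) (u : 'rV[R]_m) : 0 <= dotp u u.
Proof. by rewrite dotpE sumr_ge0// => i _; rewrite -expr2 sqr_ge0. Qed.

Lemma enorm_sqr (R : realType) (m : nat) (u : 'rV[R]_m) :
  enorm u ^+ 2 = dotp u u.
Proof. by rewrite sqr_sqrtr// dotp_ge0. Qed.

Lemma mx_entry_le (R : realType) (m n : nat) (A : 'M[R]_(m, n)) i j :
  `|A i j| <= `|A|.
Proof.
rewrite {2}/Num.norm/= mx_normrE.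
exact: (le_bigmax_cond _ (fun ij : 'I_m * 'I_n => `|A ij.1 ij.2|) (j := (i, j))).
Qed.

Lemma norm_le_enorm (R : realType) (m : nat) (u : 'rV[R]_m) : `|u| <= enorm u.
Proof.
rewrite {1}/Num.norm/= mx_normrE; apply: bigmax_le => [|[i j] _ /=].
  exact: sqrtr_ge0.
rewrite ord1 -sqrtr_sqr ler_sqrt ?sqr_ge0 ?dotp_ge0// dotpE (bigD1 j)//= expr2.
by rewrite lerDl sumr_ge0// => k _; rewrite -expr2 sqr_ge0.
Qed.

Lemma normsq_le_dotp (R : realType) (m : nat) (u : 'rV[R]_m) :
  `|u| ^+ 2 <= dotp u u.
Proof. by rewrite -enorm_sqr lerXn2r ?nnegrE ?sqrtr_ge0 ?norm_le_enorm. Qed.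

Lemma dotp_le_norm (R : realType) (m : nat) (u v : 'rV[R]_m) :
  `|dotp u v| <= m%:R * (`|u| * `|v|).
Proof.
rewrite dotpE (le_trans (ler_norm_sum _ _ _))//.
rewrite -[X in X%:R]card_ord mulr_natl -sumr_const ler_sum// => i _.
by rewrite normrM ler_pM// mx_entry_le.
Qed.

Lemma mulmx_le_norm (R : realType) (m : nat) (u : 'rV[R]_m) (A : 'M[R]_m) :
  `|u *m A| <= m%:R * (`|u| * `|A|).
Proof.
rewrite {1}/Num.norm/= mx_normrE; apply: bigmax_le => [|[i j] _ /=].
  by rewrite !mulr_ge0.
rewrite mxE (le_trans (ler_norm_sum _ _ _))//.
rewrite -[X in X%:R]card_ord mulr_natl -sumr_const ler_sum// => k _.
by rewrite normrM ler_pM// mx_entry_le.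
Qed.

(** * Quadratic forms *)

Definition qform (R : realType) (m : nat) (A : 'M[R]_m) (u : 'rV[R]_m) : R :=
  dotp (u *m A) u.

Lemma qform_le_norm (R : realType) (m : nat) (A : 'M[R]_m) (u : 'rV[R]_m) :
  `|qform A u| <= m%:R ^+ 2 * `|A| * `|u| ^+ 2.
Proof.
rewrite (le_trans (dotp_le_norm _ _))//.
have -> : m%:R ^+ 2 * `|A| * `|u| ^+ 2 = m%:R * (m%:R * (`|u| * `|A|) * `|u|).
  by ring.
by rewrite ler_wpM2l// ler_wpM2r// mulmx_le_norm.
Qed.

Lemma dotpl_continuous (R : realType) (m : nat) (v : 'rV[R]_m) :
  continuous (fun u => dotp u v).
Proof.
move=> u; rewrite /continuous_at.
rewrite (_ : (fun _ => _) = fun u : 'rV[R]_m => \sum_i u 0 i * v 0 i).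
  rewrite dotpE; refine (cvg_big add_continuous (nbhs_filter u) _) => i _.
  by apply: cvgM; [exact: coord_continuous|exact: cvg_cst].
by apply/funext => w; rewrite dotpE.
Qed.

Lemma qform_continuous (R : realType) (m : nat) (A : 'M[R]_m) :
  continuous (qform A).
Proof.
move=> u; rewrite /continuous_at /qform.
rewrite (_ : (fun _ => _) = fun u : 'rV[R]_m =>
    \sum_i (\sum_j u 0 j * A j i) * u 0 i).
  rewrite dotpE; refine (cvg_big add_continuous (nbhs_filter u) _) => i _.
  apply: cvgM; last exact: coord_continuous.
  rewrite mxE; refine (cvg_big add_continuous (nbhs_filter u) _) => j _.
  by apply: cvgM; [exact: coord_continuous|exact: cvg_cst].
by apply/funext => w; rewrite dotpE; apply: eq_bigr => i _; rewrite mxE.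
Qed.

Lemma qformZ (R : realType) (m : nat) (A : 'M[R]_m) (a : R) (u : 'rV[R]_m) :
  qform A (a *: u) = a ^+ 2 * qform A u.
Proof. by rewrite /qform -scalemxAl dotpZl dotpZr mulrA expr2. Qed.

(** The form is homogeneous of degree 2, so its minimum on the unit sphere of
    the sup norm, attained by compactness, is the constant. *)
Lemma posdef_coercive (R : realType) (m : nat) (A : 'M[R]_m) :
  posdef A -> exists2 c : R, 0 < c & forall u, c * `|u| ^+ 2 <= qform A u.
Proof.
move=> Apos; pose S : set 'rV[R]_m := [set u | `|u| = 1].
have q0 : qform A 0 = 0 by rewrite -(scale0r 0) qformZ expr0n mul0r.
have homog u : u != 0 -> exists2 w, S w & qform A u = `|u| ^+ 2 * qform A w.
  move=> u0; have n0 : `|u| != 0 by rewrite normr_eq0.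
  exists (`|u|^-1 *: u); first by rewrite /S/= normrZ normfV normr_id mulVf.
  by rewrite -qformZ scalerA divff// scale1r.
have [S0|/set0P S0] := eqVneq S set0.
  (* The sphere is empty exactly in dimension 0, where 0 is the only vector. *)
  exists 1 => // u; have [->|/homog[w]] := eqVneq u 0.
    by rewrite q0 normr0 expr0n mulr0.
  by rewrite S0.
have Scomp : compact S.
  apply: bounded_closed_compact.
    by exists 1; split => // M M1 u /= ->; exact: ltW.
  apply: (@closed_comp _ _ (fun u : 'rV[R]_m => `|u|) [set 1]).
    by move=> u _; exact: norm_continuous.
  exact: closed_eq.
have Scont : {within S, continuous (qform A)}.
  exact/continuous_subspaceT/qform_continuous.
have [w /set_mem wS wmin] := EVT_min_rV S0 Scomp Scont.
have w0 : w != 0 by rewrite -normr_eq0 wS oner_eq0.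
exists (qform A w) => [|u]; first exact: Apos.
have [->|/homog[z zS ->]] := eqVneq u 0; first by rewrite q0 normr0 expr0n mulr0.
by rewrite mulrC ler_wpM2l ?sqr_ge0// wmin// mem_set.
Qed.

(** One constant serves all the matrices H y with y close to x: this uniformity
    is what lets the intermediate point of a Taylor formula be unknown. *)
Lemma qform_near_le (R : realType) (m : nat) (H : 'rV[R]_m -> 'M[R]_m)
    (x : 'rV[R]_m) :
  {for x, continuous H} ->
  exists2 C : R, 0 <= C &
    \forall y \near x, forall u, qform (H y) u <= C * dotp u u.
Proof.
move=> Hc; exists (m%:R ^+ 2 * (`|H x| + 1)); first by rewrite mulr_ge0// addr_ge0.
have Hnear : \forall y \near x, `|H x - H y| < 1.
  exact: (cvgr_dist_lt _ _ Hc _ ltr01).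
apply: filterS Hnear => y Hy u.
rewrite (le_trans (ler_norm _))// (le_trans (qform_le_norm _ _))//.
rewrite ler_pM ?mulr_ge0 ?sqr_ge0 ?normsq_le_dotp// ler_wpM2l ?sqr_ge0//.
rewrite -lerBlDl (le_trans (lerB_dist _ _))// distrC.
exact: ltW.
Qed.

(** Perturbing H x by a matrix of sup norm at most c / (2 (m^2 + 1)) costs at
    most half of the coercivity constant c of H x. *)
Lemma qform_near_ge (R : realType) (m : nat) (H : 'rV[R]_m -> 'M[R]_m)
    (x : 'rV[R]_m) :
  {for x, continuous H} -> posdef (H x) ->
  exists2 c : R, 0 < c &
    \forall y \near x, forall u, c * dotp u u <= qform (H y) u.
Proof.
move=> Hc /posdef_coercive[c c0 cH].
have m0 : (0 : R) <= m%:R by [].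
(* The divisors m + 1 and m^2 + 1 replace m and m^2 to stay positive if m = 0. *)
exists (c / 2 / (m%:R + 1)); first by rewrite !divr_gt0// ltr_wpDl.
have e0 : 0 < c / 2 / (m%:R ^+ 2 + 1) by rewrite !divr_gt0// ltr_wpDl// sqr_ge0.
have Hnear : \forall y \near x, `|H x - H y| < c / 2 / (m%:R ^+ 2 + 1).
  exact: (cvgr_dist_lt _ _ Hc _ e0).
apply: filterS Hnear => y Hy u.
have qE : qform (H y) u = qform (H x) u - qform (H x - H y) u.
  by rewrite /qform mulmxBr dotpBl; ring.
have := qform_le_norm (H x - H y) u => /(le_trans (ler_norm _)) qle.
have le1 : m%:R ^+ 2 * `|H x - H y| <= c / 2.
  rewrite (@le_trans _ _ ((m%:R ^+ 2 + 1) * `|H x - H y|))//.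
    by rewrite ler_wpM2r// lerDl.
  by rewrite mulrC -ler_pdivlMr ?ltr_wpDl ?sqr_ge0//; exact: ltW.
have le2 : m%:R ^+ 2 * `|H x - H y| * `|u| ^+ 2 <= c / 2 * `|u| ^+ 2.
  by rewrite ler_wpM2r ?sqr_ge0.
have le3 : c / 2 / (m%:R + 1) * dotp u u <= c / 2 * `|u| ^+ 2.
  have c2 : 0 <= c / 2 by rewrite divr_ge0// ltW.
  rewrite -mulrA ler_wpM2l//.
  rewrite [_^-1 * _]mulrC ler_pdivrMr ?ltr_wpDl//.
  have := dotp_le_norm u u => /(le_trans (ler_norm _)).
  by have := sqr_ge0 `|u|; rewrite expr2; nra.
have := cH u.
rewrite qE; lra.
Qed.

(** * Taylor formula of order two along a segment *)

(** Subtract from p the parabola vanishing at 0 that has the slope of p at 0 and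
    the increment of p over [0, 1]. The difference k satisfies k 0 = k 1 and
    k' 0 = 0: the mean value theorem gives a zero c of k' in ]0, 1[, then a zero
    of k'' in ]0, c[. *)
Lemma taylor_lagrange2 (R : realType) (p p1 p2 : R -> R) :
  (forall t : R, t \in `[0, 1] -> is_derive t 1 p (p1 t)) ->
  (forall t : R, t \in `[0, 1] -> is_derive t 1 p1 (p2 t)) ->
  exists2 t : R, t \in `[0, 1] & p 1 = p 0 + p1 0 + 2^-1 * p2 t.
Proof.
move=> dp dp1; pose M := p 1 - p 0 - p1 0.
pose k t := p t - (p1 0 * t + M * t ^+ 2); pose k1 t := p1 t - (p1 0 + 2 * M * t).
have dk (t : R) : t \in `[0, 1] -> is_derive t 1 k (k1 t).
  move=> /dp dpt; apply: is_derive_eq; rewrite /k1.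
  by rewrite /GRing.scale/=; ring.
have dk1 (t : R) : t \in `[0, 1] -> is_derive t 1 k1 (p2 t - 2 * M).
  move=> /dp1 dpt; apply: is_derive_eq.
  by rewrite /GRing.scale/=; ring.
have cont (h h' : R -> R) (b : R) : b <= 1 ->
    (forall t : R, t \in `[0, 1] -> is_derive t 1 h (h' t)) ->
    {within `[0, b], continuous h}.
  move=> b1 dh; apply: derivable_within_continuous => t; rewrite in_itv/= => tb.
  have tI : t \in `[0, 1] by rewrite in_itv/=; lra.
  by have [] := dh _ tI.
have sub01 (b t : R) : b <= 1 -> t \in `]0, b[ -> t \in `[0, 1].
  by rewrite !in_itv/=; lra.
have dk_in (t : R) : t \in `]0, 1[ -> is_derive t 1 k (k1 t).
  by move=> /(sub01 _ _ (lexx 1))/dk.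
(* k takes the same value p 0 at 0 and at 1, whence k' c = 0. *)
have [c] := MVT ltr01 dk_in (cont _ _ _ (lexx 1) dk).
rewrite in_itv/= => cI kc.
have k1c : k1 c = 0 by move: kc; rewrite /k /k1 /M; lra.
have c0 : 0 < c by lra.
have c1 : c <= 1 by lra.
have dk1_in (t : R) : t \in `]0, c[ -> is_derive t 1 k1 (p2 t - 2 * M).
  by move=> /(sub01 _ _ c1)/dk1.
have [s] := MVT c0 dk1_in (cont _ _ _ c1 dk1).
rewrite in_itv/= => sI k1s; exists s; first by rewrite in_itv/=; lra.
have : p2 s - 2 * M = 0.
  have : (p2 s - 2 * M) * c == 0.
    by move: k1s; rewrite subr0 k1c /k1 => <-; apply/eqP; ring.
  by rewrite mulf_eq0 => /orP[/eqP//|]; rewrite gt_eqF.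
rewrite /M; lra.
Qed.

(** The difference quotients of s |-> G (x + s d) at t are those of G at
    x + t d in direction d. *)
Lemma is_derive_line (R : realType) (V W : normedModType R) (G : V -> W)
    (x d : V) (t : R) :
  derivable G (x + t *: d) d ->
  is_derive t 1 (fun s => G (x + s *: d)) ('D_d G (x + t *: d)).
Proof.
move=> dG.
have quotE : (fun h : R => h^-1 *: (((fun s => G (x + s *: d)) \o shift t)
      (h *: (1 : R)) - G (x + t *: d))) =
    fun h => h^-1 *: ((G \o shift (x + t *: d)) (h *: d) - G (x + t *: d)).
  apply/funext => h /=; congr (_ *: (G _ - _)).
  by rewrite [_ *: 1]mulr1 scalerDl addrCA.
by split; rewrite /derivable /derive quotE.
Qed.

Lemma is_derive_dotpl (R : realType) (m : nat) (h : R -> 'rV[R]_m) (w : 'rV[R]_m)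
    (t : R) (dh : 'rV[R]_m) :
  is_derive t 1 h dh -> is_derive t 1 (fun s => dotp (h s) w) (dotp dh w).
Proof.
move=> [derh <-].
have cvgq : (fun e : R => e^-1 *: (((fun s => dotp (h s) w) \o shift t)
    (e *: (1 : R)) - dotp (h t) w)) @ 0^' --> dotp ('D_1 h t) w.
  rewrite (_ : (fun _ => _) = (fun u => dotp u w) \o
      (fun e : R => e^-1 *: ((h \o shift t) (e *: (1 : R)) - h t))).
    by apply: continuous_cvg => //; exact: dotpl_continuous.
  by apply/funext => e /=; rewrite dotpZl dotpBl.
split; last exact: cvg_lim cvgq.
by apply/cvg_ex; eexists; exact: cvgq.
Qed.

Lemma diff_gradient (R : realType) (m : nat) (g : 'rV[R]_m -> R) (x d : 'rV[R]_m) :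
  differentiable g x -> 'D_d g x = dotp (gradient g x) d.
Proof.
move=> dg; rewrite deriveE// {1}[d]row_sum_delta raddf_sum/= dotpE.
by apply: eq_bigr => i _; rewrite linearZ/= mxE deriveE// mulrC.
Qed.

(** Restricted to the segment, g has first derivative <gradient g, d> and second
    derivative the form of its Hessian at d. *)
Lemma segment_taylor2 (R : realType) (m : nat) (U : set 'rV[R]_m)
    (g : 'rV[R]_m -> R) (x d : 'rV[R]_m) :
  C2_on U g -> (forall t : R, t \in `[0, 1] -> U (x + t *: d)) ->
  exists2 t : R, t \in `[0, 1] &
    g (x + d) = g x + dotp (gradient g x) d +
      2^-1 * qform (hessian g (x + t *: d)) d.
Proof.
move=> gC2 segU.
have [t|t|t tI] := @taylor_lagrange2 R (fun t => g (x + t *: d))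
    (fun t => dotp (gradient g (x + t *: d)) d)
    (fun t => qform (hessian g (x + t *: d)) d).
- move=> /segU /gC2[dg _ _]; rewrite -diff_gradient//.
  exact/is_derive_line/diff_derivable.
- move=> /segU /gC2[_ dg _]; rewrite /qform /hessian -deriveEjacobian//.
  exact/is_derive_dotpl/is_derive_line/diff_derivable.
by rewrite scale1r scale0r addr0 => ->; exists t.
Qed.

(** A sup-norm ball inside P contains the Euclidean ball of the same radius and
    is convex. *)
Lemma near_segment (R : realType) (m : nat) (P : set 'rV[R]_m) (xbar : 'rV[R]_m) :
  (\forall x \near xbar, P x) ->
  exists2 e : R, 0 < e & forall x y : 'rV[R]_m,
    enorm (x - xbar) < e -> enorm (y - xbar) < e ->
    forall t : R, t \in `[0, 1] -> P (x + t *: (y - x)).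
Proof.
move=> /nbhs_ballP[e /= e0 eP]; exists e => // x y xe ye t.
rewrite in_itv/= => /andP[t0 t1]; apply: eP.
rewrite -ball_normE/= distrC.
have -> : x + t *: (y - x) - xbar = (1 - t) *: (x - xbar) + t *: (y - xbar).
  by apply/rowP => i; rewrite !mxE; ring.
rewrite (le_lt_trans (ler_normD _ _))// !normrZ (ger0_norm t0).
rewrite ger0_norm ?subr_ge0//.
have := le_lt_trans (norm_le_enorm _) xe; have := le_lt_trans (norm_le_enorm _) ye.
move: (`|x - xbar|) (`|y - xbar|) => a b be ae.
have [ab|ba] := leP a b.
  apply: (le_lt_trans _ be); nra.
apply: (le_lt_trans _ ae); nra.
Qed.

(** * Comparison of the penalties *)

(** The Bregman distance is exactly the remainder of the first-order expansion
    of phi, i.e. half of the Hessian form at an intermediate point. *)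
Lemma bregman_qform (R : realType) (m : nat) (phi : 'rV[R]_m -> \bar R)
    (x x' : 'rV[R]_m) :
  Defs.proper phi -> C2_on (interior (edom phi)) (fine \o phi) ->
  (forall t : R, t \in `[0, 1] -> interior (edom phi) (x + t *: (x' - x))) ->
  exists2 t : R, t \in `[0, 1] &
    bregman phi x' x =
      (2^-1 * qform (hessian (fine \o phi) (x + t *: (x' - x))) (x' - x))%:E.
Proof.
move=> [_ phigt] phiC2 seg.
have phifin z : interior (edom phi) z -> phi z = (fine (phi z))%:E.
  by move=> /interior_subset zd; rewrite fineK// fin_numE -ltey -ltNye zd phigt.
have Ux : interior (edom phi) x.
  by have := seg 0; rewrite in_itv/= lexx ler01 scale0r addr0; exact.
have Ux' : interior (edom phi) x'.
  by have := seg 1; rewrite in_itv/= lexx ler01 scale1r addrC subrK; exact.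
have [t tI] := segment_taylor2 phiC2 seg.
rewrite [x + (x' - x)]addrC subrK /= => phix'.
exists t => //; rewrite /bregman mem_set// (phifin x)// (phifin x')// phix'.
by rewrite -!EFinB; congr EFin; ring.
Qed.

(** Only the values of the penalties near xbar matter, and a factor k between
    them turns the parameter r into r k. *)
Lemma prox_regular_for_le (R : realType) (m : nat) (U U' : set 'rV[R]_m)
    (B B' : 'rV[R]_m -> 'rV[R]_m -> \bar R) (f : 'rV[R]_m -> \bar R)
    (xbar vbar : 'rV[R]_m) (d k : R) :
  0 < d -> 0 <= k ->
  (forall x, enorm (x - xbar) < d -> U' x) ->
  (forall x' x, enorm (x' - xbar) < d -> enorm (x - xbar) < d ->
    (B x' x <= k%:E * B' x' x)%E) ->
  prox_regular_for U B f xbar vbar -> prox_regular_for U' B' f xbar vbar.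
Proof.
move=> d0 k0 U'd BB' [Uxbar fxbar flsc fv [e [r [e0 r0 _ ineq]]]].
split => //.
  apply: U'd; rewrite subrr /enorm dotpE big1 ?sqrtr0// => i _.
  by rewrite !mxE mul0r.
exists (Num.min e d), (r * k); split.
- by rewrite lt_min e0.
- exact: mulr_ge0.
- by move=> x; rewrite lt_min => /andP[_ /U'd].
move=> x' x v; rewrite !lt_min => /andP[x'e x'd] /andP[xe xd] fx fxv /andP[ve _].
have {}fx : (f x - f xbar < e%:E)%E.
  by rewrite (lt_le_trans fx)// lee_fin ge_min lexx.
apply: le_trans (ineq _ _ _ x'e xe fx fxv ve).
by rewrite leeB// EFinM -muleA lee_wpmul2l ?lee_fin// BB'.
Qed.

Theorem proposition3p17 (R : realType) (m : nat) (phi : 'rV[R]_m -> \bar R)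
    (phi_Gamma0 : Gamma0 phi) (phi_legendre : legendre phi)
    (phi_C2 : C2_on (interior (edom phi)) (fine \o phi))
    (f : 'rV[R]_m -> \bar R) (xbar vbar : 'rV[R]_m)
    (xbar_int : interior (edom phi) xbar) :
  (relatively_prox_regular phi f xbar vbar -> prox_regular f xbar vbar) /\
  ((forall x : 'rV[R]_m, interior (edom phi) x -> posdef (hessian (fine \o phi) x)) ->
   prox_regular f xbar vbar -> relatively_prox_regular phi f xbar vbar).
Proof.
have [phi_proper _ _] := phi_Gamma0.
have [_ _ Hcont] := phi_C2 _ xbar_int.
have nearU : \forall x \near xbar, interior (edom phi) x.
  exact: open_nbhs_nbhs (conj (open_interior _) xbar_int).
split => [|/(_ _ xbar_int) Hpos].
- have [C C0 HC] := qform_near_le Hcont.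
  have [d d0 dP] := near_segment (filterI nearU HC).
  apply: (prox_regular_for_le d0 C0) => // x' x x'd xd.
  have [|t tI ->] := @bregman_qform _ _ _ x x' phi_proper phi_C2.
    by move=> t tI; have [] := dP _ _ xd x'd t tI.
  have [_ /(_ (x' - x)) Hle] := dP _ _ xd x'd t tI.
  by rewrite -EFinM lee_fin enorm_sqr mulrCA ler_wpM2l.
- have [c c0 Hc] := qform_near_ge Hcont Hpos.
  have [d d0 dP] := near_segment (filterI nearU Hc).
  have c'0 : 0 <= c^-1 by rewrite invr_ge0 ltW.
  apply: (prox_regular_for_le d0 c'0).
    move=> x xd; have [] := dP _ _ xd xd 0; first by rewrite in_itv/= lexx ler01.
    by rewrite scale0r addr0.
  move=> x' x x'd xd.
  have [|t tI ->] := @bregman_qform _ _ _ x x' phi_proper phi_C2.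
    by move=> t tI; have [] := dP _ _ xd x'd t tI.
  have [_ /(_ (x' - x)) Hge] := dP _ _ xd x'd t tI.
  rewrite -EFinM lee_fin enorm_sqr mulrCA ler_wpM2l// mulrC ler_pdivlMr//.
  by rewrite mulrC.
Qed.
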